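(* Let $a\in\mathbb{R}\setminus\{0\}$, $T>0$, $n\ge 1$, and let $\gamma\in\mathcal{P}_T$ be a critical curve of $\mathcal{B}_a$ constrained by $\mathcal{A}$ in the standard symplectic vector space $(\mathbb{R}^{2n},\omega)$. Then $\gamma$ is contained in a symplectic affine 2-plane of $(\mathbb{R}^{2n},\omega)$, i.e. in a translate of a 2-dimensional linear subspace on which $\omega$ is non-degenerate.
   Context: A smooth closed curve $\gamma$ in $(\mathbb{R}^{2n},\omega)$ is symplectically star-shaped if $\omega(\gamma(t),\gamma'(t))>0$ for all $t$, and symplectically convex if $\omega(\gamma'(t),\gamma''(t))>0$ for all $t$. $\mathcal{P}_T$ denotes the space of smooth $T$-periodic curves $\gamma:\mathbb{R}\to\mathbb{R}^{2n}$ that are both symplectically star-shaped and symplectically convex. Define $\mathcal{A}(\gamma)=\int_0^T\omega(\gamma,\gamma')\,dt$ and $\mathcal{B}_a(\gamma)=\int_0^T\omega(\gamma',\gamma'')^a\,dt$. A curve $\gamma\in\mathcal{P}_T$ is a critical curve (relative extremum of $\mathcal{B}_a$ constrained by $\mathcal{A}$) if there is a Lagrange multiplier $\lambda\in\mathbb{R}$ such that for every smooth $T$-periodic vector field $v:\mathbb{R}\to\mathbb{R}^{2n}$ one has $\frac{d}{d\varepsilon}\big|_{\varepsilon=0}\big[\lambda\mathcal{A}(\gamma+\varepsilon v)+\mathcal{B}_a(\gamma+\varepsilon v)\big]=0$. *)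

(* Defs.v *)
From HB Require Import structures.
From mathcomp Require Import all_boot all_order all_algebra.
From mathcomp Require Import all_classical all_reals all_analysis.

Set Implicit Arguments.
Unset Strict Implicit.
Unset Printing Implicit Defensive.

Import Order.TTheory GRing.Theory Num.Theory.
Import numFieldNormedType.Exports.

Local Open Scope classical_set_scope.
Local Open Scope ring_scope.

(* R^{2n} is 'rV[R]_(n + n): the first n coordinates are x_1, ..., x_n and the
   last n are y_1, ..., y_n, so that omega = sum_i dx_i /\ dy_i. *)
Definition omega (R : realType) (n : nat) (u v : 'rV[R]_(n + n)) : R :=
  \sum_(i < n) (u 0 (lshift n i) * v 0 (rshift n i)
                - u 0 (rshift n i) * v 0 (lshift n i)).

Definition smooth (R : realType) (m : nat) (g : R -> 'rV[R]_m) : Prop :=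
  forall (k : nat) (t : R), derivable (derive1n k g) t 1.

Definition sympl_star_shaped (R : realType) (n : nat)
    (g : R -> 'rV[R]_(n + n)) : Prop :=
  forall t : R, 0 < omega (g t) (derive1 g t).

Definition sympl_convex (R : realType) (n : nat)
    (g : R -> 'rV[R]_(n + n)) : Prop :=
  forall t : R, 0 < omega (derive1 g t) (derive1n 2 g t).

(* T is a period, not necessarily the least one. *)
Definition smooth_periodic (R : realType) (m : nat) (T : R)
    (g : R -> 'rV[R]_m) : Prop :=
  smooth g /\ periodic g T.

Definition curve_space (R : realType) (n : nat) (T : R) :
    set (R -> 'rV[R]_(n + n)) :=
  [set g | [/\ smooth_periodic T g, sympl_star_shaped g & sympl_convex g]].

Definition area (R : realType) (n : nat) (T : R)
    (g : R -> 'rV[R]_(n + n)) : R :=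
  \int[lebesgue_measure]_(t in `[0, T]) omega (g t) (derive1 g t).

Definition affine_energy (R : realType) (n : nat) (T a : R)
    (g : R -> 'rV[R]_(n + n)) : R :=
  \int[lebesgue_measure]_(t in `[0, T]) (omega (derive1 g t) (derive1n 2 g t) `^ a).

(* The perturbed curve need only be symplectically convex for small e, which is
   all that the derivative at e = 0 sees; elsewhere powR takes junk values. *)
Definition critical_curve (R : realType) (n : nat) (T a : R)
    (g : R -> 'rV[R]_(n + n)) : Prop :=
  exists lambda : R, forall v : R -> 'rV[R]_(n + n), smooth_periodic T v ->
    is_derive (0 : R) (1 : R)
      (fun e : R => lambda * area T (fun t => g t + e *: v t)
                    + affine_energy T a (fun t => g t + e *: v t))
      0.

Definition symplectic_subspace (R : realType) (n : nat)
    (U : {vspace 'rV[R]_(n + n)}) : Prop :=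
  forall u, u \in U -> (forall v, v \in U -> omega u v = 0) -> u = 0.

(* Main.v *)
(* Put h = omega(g', g''), let f = a h^(a-1) be the energy weight and
   w = 2 f g'' + f' g' - 2 lambda g the momentum. Integrating by parts, the
   first variation along v is - \int omega(v, w'). Since w is smooth and
   periodic, the fields v = omega(e, w') e are admissible for every constant
   vector e, whence \int omega(e, w')^2 = 0: thus w' = 0 and
     2 f g'' + f' g' = 2 lambda g + c.
   If lambda = 0, then omega(g, c) is periodic with derivative
   omega(g', c) = 2 f h = 2 a h^a, which never vanishes: this contradicts Rolle.
   Otherwise d = g + c / (2 lambda) satisfies 2 f d'' + f' d' = 2 lambda d, so
   lambda omega(d, d') = - f h never vanishes, d and d' span a symplectic plane,
   and the symplectic projection onto this plane has derivative 0: the plane is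
   fixed and contains d(t) for all t. *)

Require Import Defs.
From HB Require Import structures.
From mathcomp Require Import all_boot all_order all_algebra.
From mathcomp Require Import all_classical all_reals all_analysis.
From mathcomp Require Import ring.

Set Implicit Arguments.
Unset Strict Implicit.
Unset Printing Implicit Defensive.

Import Order.TTheory GRing.Theory Num.Theory.
Import numFieldNormedType.Exports.

Local Open Scope classical_set_scope.
Local Open Scope ring_scope.

Section bilinear_calculus.
Context {R : numFieldType}.
Implicit Types U V W : normedModType R.

Lemma is_derive_bilin {U V W} (B : {bilinear U -> V -> W})
    (u : R -> U) (v : R -> V) (t : R) (du : U) (dv : V) :
  continuous (fun p : U * V => B p.1 p.2) ->
  is_derive t (1 : R) u du -> is_derive t (1 : R) v dv ->
  is_derive t (1 : R) (fun x => B (u x) (v x)) (B du (v t) + B (u t) dv).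
Proof.
move=> cB [/derivable1_diffP diff_u <-] [/derivable1_diffP diff_v <-].
have diff_uv := differentiable_pair diff_u diff_v.
have diff_B := differentiable_bilin (u t, v t) cB.
have diff_Buv := differentiable_comp diff_uv diff_B.
apply: DeriveDef; first exact/derivable1_diffP.
rewrite !deriveE// (diff_comp diff_uv diff_B) diff_pair//=.
by rewrite diff_bilin//= addrC.
Qed.

Lemma scaler_is_bilinear {V} : bilinear_for
  (GRing.Scale.Law.clone _ _ *:%R _) (GRing.Scale.Law.clone _ _ *:%R _)
  (@GRing.scale R V).
Proof.
split=> [u|c] a x y /=; first by rewrite scalerDl scalerA.
by rewrite scalerDr !scalerA mulrC.
Qed.
HB.instance Definition _ V :=
  bilinear_isBilinear.Build R R V V _ _ (@GRing.scale R V) scaler_is_bilinear.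

Lemma is_derive_scaler {V} (f : R -> R) (u : R -> V) (t df : R) (du : V) :
  is_derive t (1 : R) f df -> is_derive t (1 : R) u du ->
  is_derive t (1 : R) (fun x => f x *: u x) (df *: u t + f t *: du).
Proof.
by apply: (is_derive_bilin (B := *:%R)) => p; exact: scale_continuous.
Qed.

End bilinear_calculus.

Section derivatives_of_curves.
Context {R : realType}.
Implicit Types V : normedModType R.

Lemma is_derive1P {V} (u : R -> V) (t : R) (du : V) :
  is_derive t (1 : R) u du <-> derivable u t 1 /\ derive1 u t = du.
Proof.
split=> [[? <-]|[? <-]]; first by rewrite derive1E.
by apply: DeriveDef => //; rewrite derive1E.
Qed.

Lemma derive1_eq {V} (u du : R -> V) :
  (forall t, is_derive t (1 : R) u (du t)) -> derive1 u = du.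
Proof. by move=> Du; apply/funext => t; have /is_derive1P[] := Du t. Qed.

Lemma derivable_continuous {V} (u : R -> V) :
  (forall t, derivable u t 1) -> continuous u.
Proof. by move=> du t; exact/differentiable_continuous/derivable1_diffP. Qed.

Lemma is_derive0_cst m (u : R -> 'rV[R]_m) :
  (forall t, is_derive t (1 : R) u 0) -> forall s t, u s = u t.
Proof.
move=> Du s t; apply/rowP => j.
apply: (is_derive_0_is_cst (f := fun x => u x 0 j)) => x.
have [dux Dux0] := Du x.
apply: DeriveDef; first exact: (iffLR (derivable_mxP _ _ _)).
by have /rowP/(_ j) := Dux0; rewrite derive_mx// !mxE.
Qed.

Lemma is_derive_solution_ratio {V} (h : R -> R) (u : R -> V) (t y : R) :
  h t != 0 ->
  is_derive t (1 : R) h (y * h t) -> is_derive t (1 : R) u (y *: u t) ->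
  is_derive t (1 : R) (fun s => (h s)^-1 *: u s) 0.
Proof.
move=> h_neq0 Dh Du; have Dhu := is_derive_scaler (is_deriveV h_neq0 Dh) Du.
apply: is_derive_eq.
rewrite [X in _ + X]scalerA -scalerDl -[RHS](scale0r (u t)); congr (_ *: _).
by rewrite /GRing.scale /=; field.
Qed.

Lemma is_derive_powR_comp (h : R -> R) (b t dh : R) : 0 < h t ->
  is_derive t (1 : R) h dh ->
  is_derive t (1 : R) (fun x => h x `^ b) (b * h t `^ (b - 1) * dh).
Proof.
by move=> h_gt0 Dh; exact: is_derive1_comp (is_derive1_powR b h_gt0) Dh.
Qed.

End derivatives_of_curves.

Section infinitely_differentiable.
Context {R : realType}.
Implicit Types U V W : normedModType R.

Fixpoint times_derivable {V} (k : nat) (u : R -> V) : Prop :=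
  if k is k'.+1 then
    (forall t, derivable u t 1) /\ times_derivable k' (derive1 u)
  else True.

Definition Cinfty {V} (u : R -> V) : Prop := forall k, times_derivable k u.

Lemma smoothP m (u : R -> 'rV[R]_m) : smooth u <-> Cinfty u.
Proof.
split=> [smooth_u k|Cu k].
  elim: k u smooth_u => [//|k IHk] u smooth_u; split; first exact: smooth_u 0.
  by apply: IHk => j t; rewrite -derive1Sn.
elim: k u Cu => [|k IHk] u Cu t; first by have [] := Cu 1.
by rewrite derive1Sn; apply: IHk => j; have [] := Cu j.+1.
Qed.

Lemma times_derivable_is_derive {V} k (u : R -> V) (t : R) :
  times_derivable k.+1 u -> is_derive t (1 : R) u (derive1 u t).
Proof. by move=> [du _]; exact/is_derive1P. Qed.

Lemma times_derivable_derive1 {V} k (u : R -> V) :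
  times_derivable k.+1 u -> times_derivable k (derive1 u).
Proof. by case. Qed.

Lemma times_derivableW {V} k (u : R -> V) :
  times_derivable k.+1 u -> times_derivable k u.
Proof. by elim: k u => [//|k IHk] u [du /IHk]. Qed.

Lemma times_derivableS {V} k (u du : R -> V) :
  (forall t, is_derive t (1 : R) u (du t)) -> times_derivable k du ->
  times_derivable k.+1 u.
Proof.
move=> Du ddu; split; last by rewrite (derive1_eq Du).
by move=> t; have [] := Du t.
Qed.

Lemma times_derivable_cst {V} k (c : V) : times_derivable k (fun=> c : V).
Proof.
elim: k c => [//|k IHk] c.
by apply: (times_derivableS _ (IHk 0)) => t; exact: is_derive_cst.
Qed.

Lemma times_derivableD {V} k (u v : R -> V) :
  times_derivable k u -> times_derivable k v ->
  times_derivable k (fun t => u t + v t).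
Proof.
elim: k u v => [//|k IHk] u v [du ddu] [dv ddv].
apply: times_derivableS (IHk _ _ ddu ddv) => t.
by apply: is_deriveD; exact/is_derive1P.
Qed.

Lemma times_derivable_bilin {U V W} k (B : {bilinear U -> V -> W})
    (u : R -> U) (v : R -> V) :
  continuous (fun p : U * V => B p.1 p.2) ->
  times_derivable k u -> times_derivable k v ->
  times_derivable k (fun t => B (u t) (v t)).
Proof.
move=> cB; elim: k u v => [//|k IHk] u v du dv.
apply: (times_derivableS
  (du := fun t => B (derive1 u t) (v t) + B (u t) (derive1 v t))).
  move=> t; apply: is_derive_bilin => //.
    exact: times_derivable_is_derive du.
  exact: times_derivable_is_derive dv.
apply: times_derivableD; apply: IHk.
- exact: times_derivable_derive1.
- exact: times_derivableW.
- exact: times_derivableW.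
- exact: times_derivable_derive1.
Qed.

Lemma times_derivableM k (f h : R -> R) :
  times_derivable k f -> times_derivable k h ->
  times_derivable k (fun t => f t * h t).
Proof.
by apply: (times_derivable_bilin (B := *%R)) => p; exact: mul_continuous.
Qed.

Lemma times_derivable_powR k (h : R -> R) (b : R) : (forall t, 0 < h t) ->
  times_derivable k h -> times_derivable k (fun t => h t `^ b).
Proof.
move=> h_gt0; elim: k b => [//|k IHk] b dh.
apply: (times_derivableS (du := fun t => b * h t `^ (b - 1) * derive1 h t)).
  move=> t; apply: is_derive_powR_comp => //.
  exact: times_derivable_is_derive dh.
apply: times_derivableM; last exact: times_derivable_derive1.
apply: times_derivableM; first exact: times_derivable_cst.
by apply: IHk; exact: times_derivableW.
Qed.

Lemma Cinfty_derivable {V} (u : R -> V) :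
  Cinfty u -> forall t, derivable u t 1.
Proof. by move=> /(_ 1)[]. Qed.

Lemma Cinfty_is_derive {V} (u : R -> V) (t : R) :
  Cinfty u -> is_derive t (1 : R) u (derive1 u t).
Proof. by move=> Cu; exact: times_derivable_is_derive (Cu 1). Qed.

Lemma Cinfty_continuous {V} (u : R -> V) : Cinfty u -> continuous u.
Proof. by move=> /Cinfty_derivable; exact: derivable_continuous. Qed.

Lemma Cinfty_derive1 {V} (u : R -> V) : Cinfty u -> Cinfty (derive1 u).
Proof. by move=> Cu k; exact: times_derivable_derive1. Qed.

Lemma Cinfty_derive1n {V} (u : R -> V) j : Cinfty u -> Cinfty (derive1n j u).
Proof.
by move=> Cu; elim: j => [//|j IHj]; rewrite derive1nS; exact: Cinfty_derive1.
Qed.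

Lemma Cinfty_cst {V} (c : V) : Cinfty (fun=> c : V).
Proof. by move=> k; exact: times_derivable_cst. Qed.

Lemma CinftyD {V} (u v : R -> V) :
  Cinfty u -> Cinfty v -> Cinfty (fun t => u t + v t).
Proof. by move=> Cu Cv k; exact: times_derivableD. Qed.

Lemma Cinfty_bilin {U V W} (B : {bilinear U -> V -> W})
    (u : R -> U) (v : R -> V) :
  continuous (fun p : U * V => B p.1 p.2) ->
  Cinfty u -> Cinfty v -> Cinfty (fun t => B (u t) (v t)).
Proof. by move=> cB Cu Cv k; exact: times_derivable_bilin. Qed.

Lemma CinftyM (f h : R -> R) :
  Cinfty f -> Cinfty h -> Cinfty (fun t => f t * h t).
Proof. by move=> Cf Ch k; exact: times_derivableM. Qed.

Lemma CinftyZ {V} (f : R -> R) (u : R -> V) :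
  Cinfty f -> Cinfty u -> Cinfty (fun t => f t *: u t).
Proof. by apply: (Cinfty_bilin (B := *:%R)) => p; exact: scale_continuous. Qed.

Lemma Cinfty_powR (h : R -> R) (b : R) :
  (forall t, 0 < h t) -> Cinfty h -> Cinfty (fun t => h t `^ b).
Proof. by move=> h_gt0 Ch k; exact: times_derivable_powR. Qed.

End infinitely_differentiable.

Section periodic_functions.
Context {R : realType}.
Implicit Types (T : R) (V : normedModType R).

Lemma periodic_derive1 {V} T (u : R -> V) :
  periodic u T -> periodic (derive1 u) T.
Proof.
by move=> uT t; rewrite /derive1; under eq_fun do rewrite addrA !uT.
Qed.

Lemma periodic_derive1n {V} T (u : R -> V) j :
  periodic u T -> periodic (derive1n j u) T.
Proof.
by move=> uT; elim: j => [//|j IHj]; rewrite derive1nS; exact: periodic_derive1.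
Qed.

Lemma periodicz {V : zmodType} T (u : R -> V) (t : R) (k : int) :
  periodic u T -> u (t + k%:~R * T) = u t.
Proof.
move=> uT; case: k => m; first by rewrite -pmulrn mulr_natl periodicn.
rewrite NegzE mulrNz mulNr -pmulrn mulr_natl.
by rewrite -[in RHS](subrK (T *+ m.+1) t) periodicn.
Qed.

Lemma periodic_fundamental_domain {V : zmodType} T (u : R -> V) (t : R) :
  0 < T -> periodic u T -> exists2 s, s \in `[0, T[ & u t = u s.
Proof.
move=> T_gt0 uT; pose k := Num.floor (t / T).
exists (t + (- k)%:~R * T); last by rewrite periodicz.
have /andP[] : k%:~R <= t / T < (k + 1)%:~R by exact/real_floor_itv/num_real.
rewrite ler_pdivlMr// ltr_pdivrMr// intrD mulrDl mul1r in_itv/= => kT_le lt_kT.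
by rewrite mulrNz mulNr subr_ge0 kT_le ltrBlDl.
Qed.

End periodic_functions.

Section segment_integrals.
Context {R : realType}.
Local Notation mu := (@lebesgue_measure R).

Lemma continuous_integrable_segment (f : R -> R) (a b : R) :
  continuous f -> mu.-integrable `[a, b] (EFin \o f).
Proof.
move=> cf; apply: continuous_compact_integrable; first exact: segment_compact.
exact: continuous_subspaceT.
Qed.

Lemma continuous_RintegralD (f h : R -> R) (a b : R) :
  continuous f -> continuous h ->
  \int[mu]_(t in `[a, b]) (f t + h t)
  = \int[mu]_(t in `[a, b]) f t + \int[mu]_(t in `[a, b]) h t.
Proof.
have mab : measurable (`[a, b] : set (measurableTypeR R)) by [].
move=> cf ch.
by rewrite (RintegralD mab)//; exact: continuous_integrable_segment.
Qed.

Lemma continuous_RintegralZl (c : R) (f : R -> R) (a b : R) : continuous f ->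
  \int[mu]_(t in `[a, b]) (c * f t) = c * \int[mu]_(t in `[a, b]) f t.
Proof.
have mab : measurable (`[a, b] : set (measurableTypeR R)) by [].
move=> cf.
by rewrite (RintegralZl _ mab)//; exact: continuous_integrable_segment.
Qed.

Lemma Rintegral_periodic_derivative (T : R) (F dF : R -> R) : 0 < T ->
  (forall t, is_derive t (1 : R) F (dF t)) -> continuous dF -> periodic F T ->
  \int[mu]_(t in `[0, T]) dF t = 0.
Proof.
move=> T_gt0 DF cdF FT.
have cF : continuous F by apply: derivable_continuous => t; have [] := DF t.
rewrite /Rintegral (@continuous_FTC2 _ _ F)//.
- by rewrite -[T in F T]add0r FT -EFinB subrr.
- exact: continuous_subspaceT.
- split; first by move=> t _; have [] := DF t.
  + by apply: cvg_at_right_filter; exact: cF.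
  + by apply: cvg_at_left_filter; exact: cF.
- by move=> t _; have /is_derive1P[] := DF t.
Qed.

Lemma continuous_Rintegral_eq0 (a b : R) (f : R -> R) :
  continuous f -> (forall t, 0 <= f t) -> \int[mu]_(t in `[a, b]) f t = 0 ->
  {in `]a, b[, forall t, f t = 0}.
Proof.
move=> cf f_ge0 intf0 t t_ab; have /andP[a_lt_t t_lt_b] := t_ab.
have intf := continuous_integrable_segment a b cf.
have [_ <-] := continuous_FTC1_closed t_lt_b intf a_lt_t (cf t).
rewrite derive1E -[RHS](derive_cst (0 : R) t (1 : R)); apply: near_eq_derive.
have := near_in_itvoo t_ab; apply: filterS => x; rewrite in_itv /=.
move=> /andP[a_lt_x x_lt_b]; apply/eqP; rewrite eq_le Rintegral_ge0// andbT.
have := @Rintegral_itvB R f (BLeft a) (BRight b) x intf.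
rewrite !bnd_simp intf0 sub0r => /(_ (ltW a_lt_x) (ltW x_lt_b)) split_int.
by rewrite -oppr_ge0 [leRHS]split_int Rintegral_ge0.
Qed.

Lemma periodic_Rintegral_eq0 (T : R) (f : R -> R) : 0 < T ->
  continuous f -> periodic f T -> (forall t, 0 <= f t) ->
  \int[mu]_(t in `[0, T]) f t = 0 -> forall t, f t = 0.
Proof.
move=> T_gt0 cf fT f_ge0 intf0 t.
have f_itv := continuous_Rintegral_eq0 cf f_ge0 intf0.
have [s + ->] := periodic_fundamental_domain t T_gt0 fT.
rewrite in_itv/= le_eqVlt => /andP[/predU1P[<- _|s_gt0 s_lt_T]]; last first.
  by apply: f_itv; rewrite in_itv/= s_gt0.
have f_right0 : f x @[x --> 0^'+] --> (0 : R).
  apply: cvg_near_cst; near=> x; apply: f_itv; rewrite in_itv/=.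
  by apply/andP; split; near: x; [exact: nbhs_right_gt|exact: nbhs_right_lt].
exact: cvg_unique (cvg_at_right_filter (cf 0)) f_right0.
Unshelve. all: by end_near. Qed.

Lemma near_segment (a b e0 : R) (P : R -> R -> Prop) :
  (forall t, t \in `[a, b] -> \forall s \near t & e \near e0, P s e) ->
  \forall e \near e0, forall t, t \in `[a, b] -> P t e.
Proof.
have /compact_near_coveringP := @segment_compact R a b.
by move=> /(_ _ (nbhs e0) (fun e t => P t e)); apply.
Qed.

Lemma near_dominated_by_slice (t e0 : R) (f : R -> R -> R) :
  {for (t, e0), continuous (fun p => f p.1 p.2)} ->
  \forall s \near t & e \near e0, `|f s e| <= `|f s e0| + 1.
Proof.
move=> cf.
have cvg_slice : f p.1 e0 @[p --> (t, e0)] --> f t e0.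
  exact: (cvg_comp2 cvg_fst (cvg_cst e0) cf).
have cvg_diff : f p.1 p.2 - f p.1 e0 @[p --> (t, e0)] --> (0 : R).
  by rewrite -(subrr (f t e0)); exact: cvgB cf cvg_slice.
have : \forall p \near (t, e0), `|f p.1 p.2 - f p.1 e0| <= 1.
  exact: (cvgr0_norm_le _ cvg_diff _ ltr01).
apply: filterS => -[s e] /= close.
by rewrite -lerBlDl (le_trans (lerB_dist _ _)).
Qed.

(* The domination required under the integral sign comes for free: by
   compactness of [a, b], |dF t e| <= |dF t e0| + 1 for all e near e0. *)
Lemma is_derive_Rintegral (a b e0 : R) (F dF : R -> R -> R) :
  (forall t, t \in `[a, b] -> \forall s \near t & e \near e0,
    is_derive e (1 : R) (F s) (dF s e)) ->
  (forall t, t \in `[a, b] -> \forall s \near t & e \near e0,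
    {for s, continuous (F ^~ e)}) ->
  (forall t, t \in `[a, b] ->
    {for (t, e0), continuous (fun p => dF p.1 p.2)}) ->
  is_derive e0 (1 : R) (fun e => \int[mu]_(t in `[a, b]) F t e)
    (\int[mu]_(t in `[a, b]) dF t e0).
Proof.
move=> DF cF cdF.
have dF_le t t_ab := near_dominated_by_slice (cdF t t_ab).
have [r /= r_gt0 near_e0] : nbhs_ball e0 _ := iffLR (nbhs_ballP _ _)
  (filterI (filterI (near_segment DF) (near_segment cF)) (near_segment dF_le)).
move: near_e0; rewrite ball_itv => near_e0.
pose f e t := F t e.
have e0_itv : e0 \in `](e0 - r), (e0 + r)[.
  by rewrite in_itv/= ltrBlDr ltrDl r_gt0.
have int_f e : e \in `](e0 - r), (e0 + r)[ ->
    mu.-integrable `[a, b] (EFin \o f e).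
  move=> /near_e0[[_ cFe] _]; apply: continuous_compact_integrable.
    exact: segment_compact.
  by apply: continuous_in_subspaceT => t /[!inE]; exact: cFe.
have Df e t : e \in `](e0 - r), (e0 + r)[ -> t \in `[a, b] ->
    derivable (f ^~ t) e 1.
  by move=> /near_e0[[DFe _] _] /DFe[].
have f_le e t : e \in `](e0 - r), (e0 + r)[ -> t \in `[a, b] ->
    `|partial1of2 f e t| <= `|dF t e0| + 1.
  move=> /near_e0[[DFe _] dFe_le] t_ab.
  by rewrite /partial1of2 (iffLR (is_derive1P _ _ _) (DFe t t_ab)).2 dFe_le.
have bound_ge0 t : 0 <= `|dF t e0| + 1 by rewrite addr_ge0.
have int_bound : mu.-integrable `[a, b] (EFin \o (fun t => `|dF t e0| + 1)).
  apply: continuous_compact_integrable; first exact: segment_compact.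
  apply: continuous_in_subspaceT => t /[!inE] t_ab.
  apply: cvgD; last exact: cvg_cst.
  by apply: cvg_norm; exact: (cvg_comp2 cvg_id (cvg_cst e0) (cdF t t_ab)).
have mab : measurable (`[a, b] : set (measurableTypeR R)) by [].
apply/is_derive1P; split.
  exact: (derivable_under_integral mab e0_itv int_f Df bound_ge0 int_bound
    f_le).
rewrite (differentiation_under_integral mab e0_itv int_f Df bound_ge0 int_bound
  f_le).
apply: eq_Rintegral => t /[!inE] t_ab.
have [[DFe0 _] _] := near_e0 e0 e0_itv.
by have /is_derive1P[] := DFe0 t t_ab.
Qed.

Lemma is_derive_line {V : normedModType R} (w dw : V) (e : R) :
  is_derive e (1 : R) (fun x => w + x *: dw) dw.
Proof.
have Dcst c : is_derive e (1 : R) (fun=> c : V) 0 by exact: is_derive_cst.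
have Dscale := is_derive_scaler (is_derive_id e (1 : R)) (Dcst dw).
by have := is_deriveD (Dcst w) Dscale; rewrite add0r scale1r scaler0 addr0.
Qed.

Lemma continuous_comp_fst {V : topologicalType} (w : R -> V) :
  continuous w -> continuous (fun p : R * R => w p.1).
Proof.
move=> cw p; apply: (@continuous_comp _ _ _ fst w); first exact: cvg_fst.
exact: cw.
Qed.

Lemma continuous_line {V : normedModType R} (w dw : R -> V) :
  continuous w -> continuous dw ->
  continuous (fun p : R * R => w p.1 + p.2 *: dw p.1).
Proof.
move=> cw cdw p; apply: cvgD; first exact: continuous_comp_fst.
by apply: cvgZ; [exact: cvg_snd|exact: continuous_comp_fst].
Qed.

Lemma is_derive_Rintegral_bilin {U V : normedModType R}
    (B : {bilinear U -> V -> R}) (a b : R) (phi dphi : R -> R)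
    (u du : R -> U) (v dv : R -> V) :
  continuous (fun p : U * V => B p.1 p.2) ->
  continuous u -> continuous du -> continuous v -> continuous dv ->
  (forall t, t \in `[a, b] ->
    \forall x \near B (u t) (v t), is_derive x (1 : R) phi (dphi x)) ->
  (forall t, t \in `[a, b] -> {for B (u t) (v t), continuous dphi}) ->
  is_derive (0 : R) (1 : R)
    (fun e => \int[mu]_(t in `[a, b])
       phi (B (u t + e *: du t) (v t + e *: dv t)))
    (\int[mu]_(t in `[a, b])
       (dphi (B (u t) (v t)) * (B (du t) (v t) + B (u t) (dv t)))).
Proof.
move=> cB cu cdu cv cdv Dphi cdphi.
pose Q t e := B (u t + e *: du t) (v t + e *: dv t).
pose dQ t e := B (du t) (v t + e *: dv t) + B (u t + e *: du t) (dv t).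
have DQ t e : is_derive e (1 : R) (Q t) (dQ t e).
  by apply: is_derive_bilin => //; exact: is_derive_line.
have c_u := continuous_line cu cdu; have c_v := continuous_line cv cdv.
have cQ : continuous (fun p => Q p.1 p.2).
  by move=> p; exact: (cvg_comp2 (c_u p) (c_v p) (cB (_, _))).
have c_du := continuous_comp_fst cdu; have c_dv := continuous_comp_fst cdv.
have cdQ : continuous (fun p => dQ p.1 p.2).
  move=> p; apply: cvgD; first exact: (cvg_comp2 (c_du p) (c_v p) (cB (_, _))).
  exact: (cvg_comp2 (c_u p) (c_dv p) (cB (_, _))).
have Q0 t : Q t 0 = B (u t) (v t) by rewrite /Q !scale0r !addr0.
have dQ0 t : dQ t 0 = B (du t) (v t) + B (u t) (dv t).
  by rewrite /dQ !scale0r !addr0.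
have near_Q t : t \in `[a, b] -> \forall s \near t & e \near (0 : R),
    is_derive (Q s e) (1 : R) phi (dphi (Q s e)).
  by move=> /Dphi; rewrite -Q0; exact: (cQ (t, 0)).
under eq_Rintegral do rewrite -Q0 -dQ0.
apply: (is_derive_Rintegral (F := fun t e => phi (Q t e))
  (dF := fun t e => dphi (Q t e) * dQ t e)) => t t_ab.
- apply: filterS (near_Q t t_ab) => -[s e] /= Dphi_Q.
  exact: is_derive1_comp Dphi_Q (DQ s e).
- apply: filterS (near_Q t t_ab) => -[s e] /= [dphi_Q _].
  have cphi_Q : {for Q s e, continuous phi}.
    exact/differentiable_continuous/derivable1_diffP.
  apply: (@continuous_comp _ _ _ (Q ^~ e) phi) => //.
  exact: (cvg_comp2 cvg_id (cvg_cst e) (cQ (s, e))).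
- apply: cvgM; last exact: cdQ.
  apply: (@continuous_comp _ _ _ (fun p => Q p.1 p.2) dphi); first exact: cQ.
  by rewrite /= Q0; exact: cdphi.
Qed.

End segment_integrals.

Section symplectic_form.
Context {R : realType} {n : nat}.
Implicit Types (u v w : 'rV[R]_(n + n)) (c : R).

Lemma omegaC u v : omega u v = - omega v u.
Proof. by rewrite /omega -sumrN; apply: eq_bigr => i _; ring. Qed.

Lemma omega_is_bilinear : bilinear_for
  (GRing.Scale.Law.clone _ _ *:%R _) (GRing.Scale.Law.clone _ _ *:%R _)
  (@omega R n).
Proof.
have omegaPl v : linear_for *:%R ((@omega R n) ^~ v).
  move=> c u u'; rewrite /omega scaler_sumr -big_split.
  by apply: eq_bigr => i _; rewrite !mxE /GRing.scale /=; ring.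
split=> // u c v v'.
by rewrite omegaC omegaPl opprD -scalerN -!(omegaC u).
Qed.
HB.instance Definition _ := bilinear_isBilinear.Build R
  'rV[R]_(n + n) 'rV[R]_(n + n) R _ _ (@omega R n) omega_is_bilinear.

Lemma omegaZl c u v : omega (c *: u) v = c * omega u v.
Proof. exact: linearZl_LR. Qed.

Lemma omegaZr c u v : omega u (c *: v) = c * omega u v.
Proof. exact: linearZr_LR. Qed.

Lemma omegaxx u : omega u u = 0.
Proof. by rewrite /omega big1// => i _; ring. Qed.

Lemma omegaDl u v w : omega (u + v) w = omega u w + omega v w.
Proof. exact: linearDl. Qed.

Lemma omegaDr u v w : omega u (v + w) = omega u v + omega u w.
Proof. exact: linearDr. Qed.

Lemma omegaNl u v : omega (- u) v = - omega u v.
Proof. exact: linearNl. Qed.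

Lemma omegaNr u v : omega u (- v) = - omega u v.
Proof. exact: linearNr. Qed.

Lemma omega0l u : omega 0 u = 0.
Proof. exact: linear0l. Qed.

Lemma omega0r u : omega u 0 = 0.
Proof. exact: linear0r. Qed.

Definition omegaE :=
  (omegaDl, omegaDr, omegaNl, omegaNr, omegaZl, omegaZr, omegaxx).

Lemma omega_delta_lshift u i :
  omega (delta_mx 0 (lshift n i)) u = u 0 (rshift n i).
Proof.
rewrite /omega (bigD1 i)//= big1 => [|k ki].
  by rewrite !mxE !eqxx eq_rlshift mul0r mul1r subr0 addr0.
by rewrite !mxE eq_rlshift eq_lshift (negPf ki) !mul0r subrr.
Qed.

Lemma omega_delta_rshift u i :
  omega (delta_mx 0 (rshift n i)) u = - u 0 (lshift n i).
Proof.
rewrite /omega (bigD1 i)//= big1 => [|k ki].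
  by rewrite !mxE !eqxx eq_lrshift mul0r mul1r sub0r addr0.
by rewrite !mxE eq_lrshift eq_rshift (negPf ki) !mul0r subrr.
Qed.

Lemma omega_nondegenerate u : (forall v, omega v u = 0) -> u = 0.
Proof.
move=> u_orth; apply/rowP => j; rewrite mxE; case: (split_ordP j) => i ->.
  by rewrite -[LHS]opprK -omega_delta_rshift u_orth oppr0.
by rewrite -omega_delta_lshift u_orth.
Qed.

Lemma continuous_omega :
  continuous (fun p : 'rV[R]_(n + n) * 'rV[R]_(n + n) => omega p.1 p.2).
Proof.
pose V := 'rV[R]_(n + n).
have coord1 (j : 'I_(n + n)) : continuous (fun p : V * V => p.1 0 j).
  by move=> p; exact: continuous_comp cvg_fst (@coord_continuous _ _ _ 0 j p.1).
have coord2 (j : 'I_(n + n)) : continuous (fun p : V * V => p.2 0 j).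
  by move=> p; exact: continuous_comp cvg_snd (@coord_continuous _ _ _ 0 j p.2).
apply: continuous_big => [|i _ p]; first exact: add_continuous.
by apply: cvgB; apply: cvgM; first [exact: coord1|exact: coord2].
Qed.

Lemma is_derive_omega (u v : R -> 'rV[R]_(n + n)) (t : R) du dv :
  is_derive t (1 : R) u du -> is_derive t (1 : R) v dv ->
  is_derive t (1 : R) (fun x => omega (u x) (v x))
    (omega du (v t) + omega (u t) dv).
Proof. exact: (is_derive_bilin (B := @omega R n)) continuous_omega. Qed.

Lemma Cinfty_omega (u v : R -> 'rV[R]_(n + n)) :
  Cinfty u -> Cinfty v -> Cinfty (fun t => omega (u t) (v t)).
Proof. exact: (Cinfty_bilin (B := @omega R n)) continuous_omega. Qed.

End symplectic_form.

Section first_variation.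
Context {R : realType} {n : nat}.
Implicit Types (g v : R -> 'rV[R]_(n + n)) (f : R -> R) (T a lambda t : R).
Local Notation mu := (@lebesgue_measure R).

Definition energy_weight a g t : R :=
  a * omega (derive1 g t) (derive1n 2 g t) `^ (a - 1).

Definition area_variation g v t : R :=
  omega (v t) (derive1 g t) + omega (g t) (derive1 v t).

Definition energy_variation f g v t : R :=
  f t * (omega (derive1 v t) (derive1n 2 g t)
         + omega (derive1 g t) (derive1n 2 v t)).

Definition momentum lambda f g t : 'rV[R]_(n + n) :=
  (2 * f t) *: derive1n 2 g t + derive1 f t *: derive1 g t
  - (2 * lambda) *: g t.

Definition boundary_term lambda f g v t : R :=
  f t * omega (derive1 g t) (derive1 v t) - lambda * omega (g t) (v t)
  + omega (v t) (momentum lambda f g t).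

Lemma derive1n_perturbation g v (e : R) (j : nat) : Cinfty g -> Cinfty v ->
  derive1n j (fun t => g t + e *: v t) =
  (fun t => derive1n j g t + e *: derive1n j v t).
Proof.
move=> smooth_g smooth_v; elim: j => [//|j IHj]; rewrite !derive1nS IHj.
apply: derive1_eq => t; apply: is_deriveD; last apply: is_deriveZ.
  exact/Cinfty_is_derive/Cinfty_derive1n.
exact/Cinfty_is_derive/Cinfty_derive1n.
Qed.

Lemma is_derive_area T g v : Cinfty g -> Cinfty v ->
  is_derive (0 : R) (1 : R) (fun e => area T (fun t => g t + e *: v t))
    (\int[mu]_(t in `[0, T]) area_variation g v t).
Proof.
move=> smooth_g smooth_v.
have Dperturb e : derive1 (fun t => g t + e *: v t) =
    (fun t => derive1 g t + e *: derive1 v t).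
  by rewrite -derive1n1 derive1n_perturbation.
rewrite /area; under eq_fun do under eq_Rintegral do rewrite Dperturb.
under eq_Rintegral do rewrite -[area_variation _ _ _]mul1r.
apply: (is_derive_Rintegral_bilin (B := @omega R n) (phi := id)
  (dphi := fun=> 1)).
- exact: continuous_omega.
- exact: Cinfty_continuous.
- exact: Cinfty_continuous.
- exact/Cinfty_continuous/Cinfty_derive1.
- exact/Cinfty_continuous/Cinfty_derive1.
- by move=> t _; apply: filterE => x; exact: is_derive_id.
- by move=> t _; exact: cvg_cst.
Qed.

Lemma is_derive_affine_energy T a g v :
  Cinfty g -> Cinfty v -> sympl_convex g ->
  is_derive (0 : R) (1 : R)
    (fun e => affine_energy T a (fun t => g t + e *: v t))
    (\int[mu]_(t in `[0, T]) energy_variation (energy_weight a g) g v t).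
Proof.
move=> smooth_g smooth_v g_convex.
have Dperturb e j := derive1n_perturbation e j smooth_g smooth_v.
rewrite /affine_energy; under eq_fun do under eq_Rintegral do
  rewrite [derive1 _](Dperturb _ 1) (Dperturb _ 2).
apply: (is_derive_Rintegral_bilin (B := @omega R n)
  (phi := fun x => x `^ a) (dphi := fun x => a * x `^ (a - 1))).
- exact: continuous_omega.
- exact/Cinfty_continuous/Cinfty_derive1.
- exact/Cinfty_continuous/Cinfty_derive1.
- exact/Cinfty_continuous/Cinfty_derive1n.
- exact/Cinfty_continuous/Cinfty_derive1n.
- move=> t _; near=> x; apply: is_derive1_powR.
  by near: x; exact: lt_nbhsr (g_convex t).
- move=> t _; apply: cvgM; first exact: cvg_cst.
  have [/derivable1_diffP dpow _] := is_derive1_powR (a - 1) (g_convex t).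
  exact: differentiable_continuous dpow.
Unshelve. all: by end_near. Qed.

Lemma Cinfty_energy_weight a g :
  Cinfty g -> sympl_convex g -> Cinfty (energy_weight a g).
Proof.
move=> smooth_g g_convex; rewrite /energy_weight.
apply: CinftyM; first exact: Cinfty_cst.
apply: Cinfty_powR => //; apply: Cinfty_omega; first exact: Cinfty_derive1.
exact: Cinfty_derive1n.
Qed.

Lemma Cinfty_area_variation g v :
  Cinfty g -> Cinfty v -> Cinfty (area_variation g v).
Proof.
move=> smooth_g smooth_v; rewrite /area_variation.
apply: CinftyD; apply: Cinfty_omega => //.
  exact: Cinfty_derive1.
exact: Cinfty_derive1.
Qed.

Lemma Cinfty_energy_variation f g v :
  Cinfty f -> Cinfty g -> Cinfty v -> Cinfty (energy_variation f g v).
Proof.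
move=> smooth_f smooth_g smooth_v; rewrite /energy_variation.
apply: CinftyM => //.
apply: CinftyD; apply: Cinfty_omega;
  first [exact: Cinfty_derive1|exact: Cinfty_derive1n].
Qed.

Lemma Cinfty_momentum lambda f g :
  Cinfty f -> Cinfty g -> Cinfty (momentum lambda f g).
Proof.
move=> smooth_f smooth_g.
have smooth_accel : Cinfty (fun t => (2 * f t) *: derive1n 2 g t).
  apply: CinftyZ; last exact: Cinfty_derive1n.
  by apply: CinftyM => //; exact: Cinfty_cst.
have smooth_vel : Cinfty (fun t => derive1 f t *: derive1 g t).
  by apply: CinftyZ; exact: Cinfty_derive1.
have smooth_pos : Cinfty (fun t => - (2 * lambda) *: g t).
  by apply: CinftyZ => //; exact: Cinfty_cst.
rewrite /momentum; under eq_fun do rewrite -scaleNr.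
by apply: CinftyD => //; exact: CinftyD.
Qed.

Lemma periodic_momentum T lambda f g :
  periodic f T -> periodic g T -> periodic (momentum lambda f g) T.
Proof.
move=> fT gT t; rewrite /momentum fT gT (periodic_derive1 fT).
by rewrite (periodic_derive1 gT) (periodic_derive1n 2 gT).
Qed.

Lemma critical_curve_first_variation T a g :
  curve_space T g -> critical_curve T a g ->
  exists lambda, forall v, smooth_periodic T v ->
    \int[mu]_(t in `[0, T]) (lambda * area_variation g v t
      + energy_variation (energy_weight a g) g v t) = 0.
Proof.
move=> [[/smoothP smooth_g _] _ g_convex] [lambda crit].
exists lambda => v v_per; have [/smoothP smooth_v _] := v_per.
have [_ deriv0] := crit v v_per.
have Darea := is_derive_area T smooth_g smooth_v.
have Denergy := is_derive_affine_energy T a smooth_g smooth_v g_convex.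
have [_ derivE] := is_deriveD (is_deriveZ lambda Darea) Denergy.
have smooth_area := Cinfty_area_variation smooth_g smooth_v.
have smooth_energy : Cinfty (energy_variation (energy_weight a g) g v).
  by apply: Cinfty_energy_variation => //; exact: Cinfty_energy_weight.
have smooth_scaled_area : Cinfty (fun t => lambda * area_variation g v t).
  by apply: CinftyM => //; exact: Cinfty_cst.
rewrite -[RHS]deriv0 [RHS]derivE.
rewrite continuous_RintegralD; try exact: Cinfty_continuous.
by congr (_ + _); exact/continuous_RintegralZl/Cinfty_continuous.
Qed.

Lemma boundary_term_identity (g0 g1 g2 v0 v1 v2 dw : 'rV[R]_(n + n))
    (lambda f df : R) :
  f * (omega g2 v1 + omega g1 v2) + omega g1 v1 * df
  - lambda * (omega g1 v0 + omega g0 v1)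
  + (omega v1 ((2 * f) *: g2 + df *: g1 - (2 * lambda) *: g0) + omega v0 dw)
  = lambda * (omega v0 g1 + omega g0 v1) + f * (omega v1 g2 + omega g1 v2)
  + omega v0 dw.
Proof.
rewrite !omegaE (omegaC v0 g1) (omegaC v1 g0) (omegaC v1 g1) (omegaC v1 g2).
by ring.
Qed.

Lemma is_derive_boundary_term lambda f g v :
  Cinfty f -> Cinfty g -> Cinfty v ->
  forall t, is_derive t (1 : R) (boundary_term lambda f g v)
    (lambda * area_variation g v t + energy_variation f g v t
     + omega (v t) (derive1 (momentum lambda f g) t)).
Proof.
move=> smooth_f smooth_g smooth_v t.
have Df := Cinfty_is_derive t smooth_f.
have Dg := Cinfty_is_derive t smooth_g.
have Dv := Cinfty_is_derive t smooth_v.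
have Dw := Cinfty_is_derive t (Cinfty_momentum lambda smooth_f smooth_g).
have Ddg := Cinfty_is_derive t (Cinfty_derive1 smooth_g).
have Ddv := Cinfty_is_derive t (Cinfty_derive1 smooth_v).
have Dboundary := is_deriveD
  (is_deriveB (is_deriveM Df (is_derive_omega Ddg Ddv))
    (is_deriveZ lambda (is_derive_omega Dg Dv)))
  (is_derive_omega Dv Dw).
by apply: is_derive_eq; exact: boundary_term_identity.
Qed.

Lemma first_variation_by_parts T lambda f g v : 0 < T ->
  Cinfty f -> periodic f T -> smooth_periodic T g -> smooth_periodic T v ->
  \int[mu]_(t in `[0, T]) (lambda * area_variation g v t
      + energy_variation f g v t)
  = - \int[mu]_(t in `[0, T]) omega (v t) (derive1 (momentum lambda f g) t).
Proof.
move=> T_gt0 smooth_f fT [/smoothP smooth_g gT] [/smoothP smooth_v vT].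
pose variation t := lambda * area_variation g v t + energy_variation f g v t.
pose w := momentum lambda f g.
have smooth_w : Cinfty w by exact: Cinfty_momentum.
have smooth_variation : Cinfty variation.
  apply: CinftyD; last exact: Cinfty_energy_variation.
  by apply: CinftyM; [exact: Cinfty_cst|exact: Cinfty_area_variation].
have smooth_vw : Cinfty (fun t => omega (v t) (derive1 w t)).
  by apply: Cinfty_omega => //; exact: Cinfty_derive1.
apply/eqP; rewrite -addr_eq0.
rewrite -continuous_RintegralD; try exact: Cinfty_continuous.
apply/eqP; apply: (Rintegral_periodic_derivative T_gt0
  (is_derive_boundary_term lambda smooth_f smooth_g smooth_v)).
  exact/Cinfty_continuous/CinftyD.
move=> t; rewrite /boundary_term fT gT vT (periodic_derive1 gT).
by rewrite (periodic_derive1 vT) (periodic_momentum _ fT gT).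
Qed.

Lemma omega_orthogonal_eq0 T (u : R -> 'rV[R]_(n + n)) : 0 < T ->
  smooth_periodic T u ->
  (forall v, smooth_periodic T v ->
    \int[mu]_(t in `[0, T]) omega (v t) (u t) = 0) ->
  forall t, u t = 0.
Proof.
move=> T_gt0 [/smoothP smooth_u uT] u_orth t; apply: omega_nondegenerate => e.
have smooth_eu : Cinfty (fun s => omega e (u s)).
  by apply: Cinfty_omega => //; exact: Cinfty_cst.
apply/eqP; rewrite -sqrf_eq0; apply/eqP; move: t.
apply: (@periodic_Rintegral_eq0 R T (fun s => omega e (u s) ^+ 2)) => //.
- exact/Cinfty_continuous/CinftyM.
- by move=> s; rewrite uT.
- by move=> s; exact: sqr_ge0.
rewrite -[RHS](u_orth (fun s => omega e (u s) *: e)).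
  by apply: eq_Rintegral => s _; rewrite omegaZl expr2.
split; last by move=> s; rewrite uT.
by apply/smoothP; apply: CinftyZ => //; exact: Cinfty_cst.
Qed.

Lemma critical_curve_momentum_cst T a g : 0 < T ->
  curve_space T g -> critical_curve T a g ->
  exists (lambda : R) (c : 'rV[R]_(n + n)),
    forall t, momentum lambda (energy_weight a g) g t = c.
Proof.
move=> T_gt0 g_curve g_crit; have [g_per _ g_convex] := g_curve.
have [/smoothP smooth_g gT] := g_per.
have [lambda var0] := critical_curve_first_variation g_curve g_crit.
have smooth_f := Cinfty_energy_weight a smooth_g g_convex.
have fT : periodic (energy_weight a g) T.
  move=> t; rewrite /energy_weight (periodic_derive1 gT).
  by rewrite (periodic_derive1n 2 gT).
set w := momentum lambda (energy_weight a g) g.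
have smooth_w : Cinfty w by exact: Cinfty_momentum.
have wT : periodic w T by exact: periodic_momentum.
have dw0 : forall t, derive1 w t = 0.
  apply: (omega_orthogonal_eq0 T_gt0).
    by split; [exact/smoothP/Cinfty_derive1|exact: periodic_derive1].
  move=> v v_per.
  have := first_variation_by_parts lambda T_gt0 smooth_f fT g_per v_per.
  by rewrite var0// => /esym/eqP; rewrite oppr_eq0 => /eqP.
exists lambda, (w 0) => t; apply: is_derive0_cst => s.
by rewrite -(dw0 s); exact: Cinfty_is_derive.
Qed.

End first_variation.

Section symplectic_planes.
Context {R : realType} {n : nat}.
Local Notation V := 'rV[R]_(n + n).
Implicit Types (u v d e : V).

Lemma dim_symplectic_span u v : omega u v != 0 -> \dim <<[:: u; v]>>%VS = 2%N.
Proof.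
move=> uv; suff /eqP : free [:: u; v] by [].
rewrite free_cons span_seq1 seq1_free; apply/andP; split; last first.
  by apply: contraNneq uv => ->; rewrite omega0r.
by apply: contraNN uv => /vlineP[k ->]; rewrite omegaZl omegaxx mulr0.
Qed.

Lemma symplectic_span u v :
  omega u v != 0 -> symplectic_subspace <<[:: u; v]>>%VS.
Proof.
move=> uv w w_span w_orth.
have /eqP wu : omega w u == 0 by rewrite w_orth// memv_span// mem_head.
have /eqP wv : omega w v == 0 by rewrite w_orth// memv_span// !inE eqxx orbT.
move: w_span; rewrite span_cons span_seq1 => /memv_addP[_ /vlineP[x ->]].
move=> [_ /vlineP[y ->] w_xy]; move: wu wv.
rewrite w_xy !omegaE (omegaC v u) !mulr0 addr0 add0r => /eqP + /eqP.
rewrite !mulf_eq0 oppr_eq0 (negPf uv) !orbF => /eqP-> /eqP->.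
by rewrite !scale0r addr0.
Qed.

Definition wedge d e u : V := omega u e *: d - omega u d *: e.

Lemma wedge_span d e u : wedge d e u \in <<[:: d; e]>>%VS.
Proof. by rewrite memvB// memvZ// memv_span// !inE eqxx ?orbT. Qed.

Lemma wedge_id d e : wedge d e d = omega d e *: d.
Proof. by rewrite /wedge omegaxx scale0r subr0. Qed.

Section second_order_equation.
Variables (d : R -> V) (x y : R -> R).
Hypothesis derivable_d : forall t, derivable d t 1.
Hypothesis second_order : forall t,
  is_derive t (1 : R) (derive1 d) (x t *: d t + y t *: derive1 d t).

Let Dd t : is_derive t (1 : R) d (derive1 d t).
Proof. exact/is_derive1P. Qed.

Lemma is_derive_wronskian t :
  is_derive t (1 : R) (fun s => omega (d s) (derive1 d s))
    (y t * omega (d t) (derive1 d t)).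
Proof.
have := is_derive_omega (Dd t) (second_order t).
by rewrite !omegaE mulr0 !add0r.
Qed.

Lemma is_derive_wedge u t :
  is_derive t (1 : R) (fun s => wedge (d s) (derive1 d s) u)
    (y t *: wedge (d t) (derive1 d t) u).
Proof.
have Du : is_derive t (1 : R) (fun=> u) 0 by exact: is_derive_cst.
have Dud := is_derive_omega Du (Dd t).
have Dud' := is_derive_omega Du (second_order t).
have Dwedge := is_deriveB (is_derive_scaler Dud' (Dd t))
  (is_derive_scaler Dud (second_order t)).
apply: is_derive_eq; rewrite /wedge !omega0l !add0r !omegaE.
by apply/rowP => j; rewrite !mxE; ring.
Qed.

(* The symplectic projection onto the plane spanned by d and d', namely
   wedge d d' / omega d d', is constant: by the equation its numerator and its
   denominator have the same logarithmic derivative y. *)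
Lemma second_order_planar : (forall t, omega (d t) (derive1 d t) != 0) ->
  forall s t, d t \in <<[:: d s; derive1 d s]>>%VS.
Proof.
move=> W_neq0 s t; pose W r := omega (d r) (derive1 d r).
pose proj r := (W r)^-1 *: wedge (d r) (derive1 d r) (d t).
have -> : d t = proj t.
  by rewrite /proj wedge_id scalerA mulVf ?scale1r//; exact: W_neq0.
have -> : proj t = proj s.
  apply: is_derive0_cst => r.
  exact: is_derive_solution_ratio (W_neq0 r) (is_derive_wronskian r)
    (is_derive_wedge _ r).
by rewrite memvZ// wedge_span.
Qed.

End second_order_equation.

Lemma periodic_tangent_orthogonal (T : R) (g : R -> V) (c : V) : 0 < T ->
  (forall t, derivable g t 1) -> periodic g T ->
  exists t, omega (derive1 g t) c = 0.
Proof.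
move=> T_gt0 dg gT.
have Dgc t :
    is_derive t (1 : R) (fun s => omega (g s) c) (omega (derive1 g t) c).
  have Dc : is_derive t (1 : R) (fun=> c) 0 by exact: is_derive_cst.
  have Dg : is_derive t (1 : R) g (derive1 g t) by exact/is_derive1P.
  by have := is_derive_omega Dg Dc; rewrite omega0r addr0.
have dgc t : derivable (fun s => omega (g s) c) t 1 by have [] := Dgc t.
have [|||t _ Dgc0] := @Rolle R (fun s => omega (g s) c) 0 T T_gt0.
- by move=> t _; exact: dgc.
- exact/continuous_subspaceT/derivable_continuous.
- by rewrite -[in RHS](add0r T) gT.
exists t; have [_ <-] := Dgc t; exact: derive_val.
Qed.

Section affine_second_order_equation.
Variables (T mu : R) (g : R -> V) (p q : R -> R) (c : V).
Hypothesis T_gt0 : 0 < T.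
Hypothesis smooth_g : Cinfty g.
Hypothesis gT : periodic g T.
Hypothesis affine_equation : forall t,
  p t *: derive1n 2 g t + q t *: derive1 g t = mu *: g t + c.
Hypothesis curved : forall t,
  p t * omega (derive1 g t) (derive1n 2 g t) != 0.

Lemma omega_tangent_affine t : omega (derive1 g t) (mu *: g t + c) != 0.
Proof.
by rewrite -affine_equation omegaDr !omegaZr omegaxx mulr0 addr0 curved.
Qed.

Lemma affine_coefficient_neq0 : mu != 0.
Proof.
apply/eqP => mu0.
have [t t_orth] := periodic_tangent_orthogonal c T_gt0
  (Cinfty_derivable smooth_g) gT.
by have := omega_tangent_affine t; rewrite mu0 scale0r add0r t_orth eqxx.
Qed.

Lemma affine_second_order_planar : exists (o : V) (U : {vspace V}),
  [/\ \dim U = 2%N, symplectic_subspace U & forall t, g t - o \in U].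
Proof.
have mu_neq0 := affine_coefficient_neq0.
pose o := - (mu^-1 *: c); pose d t := g t - o.
have mu_d t : mu *: d t = mu *: g t + c.
  by rewrite /d /o opprK scalerDr scalerA mulfV// scale1r.
have Dd t : is_derive t (1 : R) d (derive1 g t).
  have := is_deriveB (Cinfty_is_derive t smooth_g) (is_derive_cst o t (1 : R)).
  by rewrite subr0.
have dE := derive1_eq Dd.
have derivable_d t : derivable d t 1 by have [] := Dd t.
have W_neq0 t : omega (d t) (derive1 d t) != 0.
  have := omega_tangent_affine t.
  by rewrite -mu_d omegaZr mulf_eq0 negb_or dE omegaC oppr_eq0 => /andP[].
exists o, <<[:: d 0%R; derive1 d 0%R]>>%VS; split.
- exact: dim_symplectic_span.
- exact: symplectic_span.
apply: (second_order_planar (x := fun t => mu / p t)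
  (y := fun t => - (q t / p t)) derivable_d _ W_neq0) => t.
have Dg' : is_derive t (1 : R) (derive1 g) (derive1n 2 g t).
  exact/Cinfty_is_derive/Cinfty_derive1.
have p_neq0 : p t != 0 by have := curved t; rewrite mulf_eq0 negb_or => /andP[].
rewrite dE; apply: is_derive_eq; apply: (scalerI p_neq0).
rewrite scalerDr !scalerA mulrN !(mulrCA (p t)) mulfV// !mulr1 mu_d.
by rewrite -affine_equation scaleNr addrK.
Qed.

End affine_second_order_equation.

End symplectic_planes.

Theorem proposition3p4 (R : realType) (n : nat) (a T : R)
    (g : R -> 'rV[R]_(n + n)) (hn : (1 <= n)%N) (ha : a != 0) (hT : 0 < T)
    (hg : curve_space T g) (hcrit : critical_curve T a g) :
  exists (p : 'rV[R]_(n + n)) (U : {vspace 'rV[R]_(n + n)}),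
    [/\ \dim U = 2%N, symplectic_subspace U & forall t : R, g t - p \in U].
Proof.
have [[/smoothP smooth_g gT] _ g_convex] := hg.
have [lambda [c momentumE]] := critical_curve_momentum_cst hT hg hcrit.
apply: (affine_second_order_planar (mu := 2 * lambda) (c := c)
  (p := fun t => 2 * energy_weight a g t)
  (q := derive1 (energy_weight a g)) hT smooth_g gT) => t.
  by rewrite -(momentumE t) /momentum subrKC.
by rewrite !mulf_neq0// gt_eqF// ?powR_gt0//; exact: g_convex.
Qed.
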